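(* If $D$ is a model of $\mathrm{ECBDA}$ or of $\mathrm{ECDA}$, then for an arbitrary set $A\subseteq D$ the definable closure $\operatorname{dcl}(A)$ and the algebraic closure $\operatorname{acl}(A)$ of $A$ in $D$ are both equal to the Boole-De Morgan subalgebra of $D$ generated by $A$.
   Context: A De Morgan algebra is a bounded distributive lattice $(D;+,\cdot,0,1)$ ($+$ join, $\cdot$ meet) with a unary operation $\bar{\ }$ satisfying $\bar{\bar x}=x$ and $\overline{x+y}=\bar x\cdot\bar y$. It is complemented if $\forall x\exists y\,(xy=0\wedge x+y=1)$. A Boole-De Morgan algebra is an algebra $(A;+,\cdot,',\bar{\ },0,1)$ such that $(A;+,\cdot,',0,1)$ is a Boolean algebra (with complement $'$) and $(A;+,\cdot,\bar{\ },0,1)$ is a De Morgan algebra. A complemented De Morgan algebra (in particular a model of $\mathrm{ECDA}$) is regarded as a Boole-De Morgan algebra by letting $x'$ be the unique lattice complement of $x$. Put $x^*:=(\bar x)'=\overline{(x')}$ (the two agree in every Boole-De Morgan algebra). For a structure $M$ and $A\subseteq M$, $\operatorname{acl}(A)$ (respectively $\operatorname{dcl}(A)$) is the union of all finite subsets (respectively singletons) of $M$ definable with parameters from $A$. Consistency: for $\sigma\in S_n$, a triple $(I_1,I_2,I_3)$ of subsets of $\{1,\dots,n\}$ is $\sigma$-consistent if $\sigma(I_2)=I_2$, $\sigma(I_3)=I_3$, and $(I_1\cap I_2\cap I_3)\cap\sigma(I_1\cap I_2\cap I_3)=\emptyset$. Theory $\mathrm{ECBDA}$: for $y=(y_1,\dots,y_n)$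 and $I_1,I_2,I_3\subseteq\{1,\dots,n\}$, let $\varphi^n_{(I_1,I_2,I_3)}(y,x)$ be the conjunction of $$\bigwedge_{i\in I_1}y_i\cdot x\bar x=0\wedge\bigwedge_{i\notin I_1}y_i\cdot x\bar x\neq0,\quad \bigwedge_{i\in I_2}y_i\cdot xx^*=0\wedge\bigwedge_{i\notin I_2}y_i\cdot xx^*\neq0,\quad \bigwedge_{i\in I_3}y_i\cdot x'\bar x=0\wedge\bigwedge_{i\notin I_3}y_i\cdot x'\bar x\neq0.$$ $\mathrm{ECBDA}$ consists of the axioms of Boole-De Morgan algebras and the sentences $$\forall y_1,\dots,y_n\Big(\bigwedge_iy_i\neq0\wedge\sum_{i=1}^ny_i=1\wedge\bigwedge_{i\neq j}y_i\cdot y_j=0\wedge\bigwedge_iy_i^*=y_{\sigma(i)}\rightarrow\exists x\,\varphi^n_{(I_1,I_2,I_3)}(y,x)\Big)$$ for each integer $n\ge1$, each $\sigma\in S_n$ with $\sigma^2$ the identity, and each $\sigma$-consistent triple $(I_1,I_2,I_3)$ of subsets of $\{1,\dots,n\}$. Theory $\mathrm{ECDA}$ (in the language $\{+,\cdot,\bar{\ },0,1\}$): for $I\subseteq\{1,\dots,n\}$ put $$\tilde\psi^n_I(y,x):=\bigwedge_{i\in I}y_i\cdot x\bar x=0\wedge\bigwedge_{i\notin I}y_i\cdot x\bar x\neq0,$$ $$\tilde\xi^n_I(y,x):=\exists z\Big(\bar x+z=1\wedge\bar xz=0\wedge\bigwedge_{i\in I}y_i\cdot xz=0\wedge\bigwedge_{i\notin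 I}y_i\cdot xz\neq0\Big),$$ $$\tilde\chi^n_I(y,x):=\exists z\Big(x+z=1\wedge xz=0\wedge\bigwedge_{i\in I}y_i\cdot z\bar x=0\wedge\bigwedge_{i\notin I}y_i\cdot z\bar x\neq0\Big),$$ and $\tilde\varphi^n_{(I_1,I_2,I_3)}:=\tilde\psi^n_{I_1}\wedge\tilde\xi^n_{I_2}\wedge\tilde\chi^n_{I_3}$. $\mathrm{ECDA}$ consists of the axioms of complemented De Morgan algebras and the sentences $$\forall y_1,\dots,y_n\Big(\bigwedge_iy_i\neq0\wedge\sum_{i=1}^ny_i=1\wedge\bigwedge_{i\neq j}y_iy_j=0\wedge\bigwedge_i(\bar y_i+y_{\sigma(i)}=1\wedge\bar y_iy_{\sigma(i)}=0)\rightarrow\exists x\,\tilde\varphi^n_{(I_1,I_2,I_3)}(y,x)\Big)$$ for the same range of $n$, $\sigma$ and $(I_1,I_2,I_3)$. *)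

(* Defs.v *)
From HB Require Import structures.
From mathcomp Require Import all_boot all_order all_fingroup.
From mathcomp Require Import boolp classical_sets cardinality.

Set Implicit Arguments.
Unset Strict Implicit.
Unset Printing Implicit Defensive.

Import Order.Theory.

Local Open Scope order_scope.

Record signature := Signature { symbol : Type; arity : symbol -> nat }.

Record structure (L : signature) := Structure {
  carrier :> Type;
  interp : forall f : symbol L, ('I_(arity f) -> carrier) -> carrier }.

Inductive term (L : signature) (n : nat) :=
| Var of 'I_n
| App (f : symbol L) of ('I_(arity f) -> term L n).

(* Formulas with free variables in 'I_n. [Ex] binds variable [ord0] of its
   body; the free variable [i] becomes [lift ord0 i] under the binder. *)
Inductive formula (L : signature) : nat -> Type :=
| Eq n of term L n & term L n : formula L n
| Not n of formula L n : formula L n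
| And n of formula L n & formula L n : formula L n
| Ex n of formula L n.+1 : formula L n.

Definition env_cons {M : Type} {n : nat} (x : M) (e : 'I_n -> M)
    (i : 'I_n.+1) : M :=
  oapp e x (unlift ord0 i).

Fixpoint eval (L : signature) (M : structure L) (n : nat)
    (e : 'I_n -> M) (t : term L n) : M :=
  match t with
  | Var i => e i
  | App f ts => interp (fun k => eval e (ts k))
  end.

Fixpoint sat (L : signature) (M : structure L) (n : nat)
    (p : formula L n) : ('I_n -> M) -> Prop :=
  match p in formula _ n return ('I_n -> M) -> Prop with
  | Eq _ t u => fun e => eval e t = eval e u
  | Not _ q => fun e => ~ sat q e
  | And _ q r => fun e => sat q e /\ sat r e
  | Ex _ q => fun e => exists x : M, sat q (env_cons x e)
  end.

Definition definable (L : signature) (M : structure L) (A X : set M) : Prop :=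
  exists (k : nat) (p : formula L k.+1) (b : 'I_k -> M),
    (forall i, A (b i)) /\ X = [set x | sat p (env_cons x b)]%classic.

Definition acl (L : signature) (M : structure L) (A : set M) : set M :=
  (\bigcup_(X in [set X : set M | finite_set X /\ definable A X]) X)%classic.

Definition dcl (L : signature) (M : structure L) (A : set M) : set M :=
  (\bigcup_(X in [set X : set M |
      (exists x, X = [set x]) /\ definable A X]) X)%classic.

HB.mixin Record hasDeMorganNegation (d : Order.disp_t) T
    of Order.TBDistrLattice d T := {
  dneg : T -> T;
  dnegK : forall x : T, dneg (dneg x) = x;
  dnegU : forall x y : T, dneg (x `|` y) = dneg x `&` dneg y }.

#[short(type="deMorganType")]
HB.structure Definition DeMorgan d :=
  { T of Order.TBDistrLattice d T & hasDeMorganNegation d T }.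

HB.mixin Record DeMorgan_isComplemented (d : Order.disp_t) T
    of DeMorgan d T := {
  complemented : forall x : T, exists y : T, x `&` y = \bot /\ x `|` y = \top }.

#[short(type="complDeMorganType")]
HB.structure Definition ComplDeMorgan d :=
  { T of DeMorgan d T & DeMorgan_isComplemented d T }.

#[short(type="booleDeMorganType")]
HB.structure Definition BooleDeMorgan d :=
  { T of Order.CTBDistrLattice d T & DeMorgan d T }.

Definition dstar {d} {D : booleDeMorganType d} (x : D) : D := ~` dneg x.

Definition is_bdm_subalgebra {d} {D : booleDeMorganType d} (S : set D) : Prop :=
  [/\ S \bot, S \top,
      forall x y, S x -> S y -> S (x `|` y) /\ S (x `&` y),
      forall x, S x -> S (~` x)
    & forall x, S x -> S (dneg x)].

Definition bdm_generated {d} {D : booleDeMorganType d} (A : set D) : set D :=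
  smallest is_bdm_subalgebra A.

(* A complemented De Morgan algebra, regarded as a Boole-De Morgan algebra on
   the same carrier, with the unique lattice complement as [~`]. *)
Definition bdm_of {d} (D : complDeMorganType d) : Type := D.

Section BdmOf.
Context {d} (D : complDeMorganType d).

Definition lattice_compl (x : D) : D :=
  xget \bot (fun y : D => x `&` y = \bot /\ x `|` y = \top).

Lemma lattice_complP (x : D) :
  x `&` lattice_compl x = \bot /\ x `|` lattice_compl x = \top.
Proof. exact: (xgetPex \bot (complemented x)). Qed.

HB.instance Definition _ := DeMorgan.on (bdm_of D).
HB.instance Definition _ :=
  Order.TBDistrLattice_hasComplement.Build d (bdm_of D)
    (fun x => (lattice_complP x).2) (fun x => (lattice_complP x).1).

End BdmOf.

Variant dm_symbol := DJoin | DMeet | DNeg | DBot | DTop.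

Definition dm_arity (f : dm_symbol) : nat :=
  match f with DJoin | DMeet => 2 | DNeg => 1 | DBot | DTop => 0 end.

Definition dm_signature := Signature dm_arity.

Definition dm_interp {d} (D : deMorganType d) (f : dm_symbol) :
    ('I_(dm_arity f) -> D) -> D :=
  match f return ('I_(dm_arity f) -> D) -> D with
  | DJoin => fun v => v ord0 `|` v ord_max
  | DMeet => fun v => v ord0 `&` v ord_max
  | DNeg => fun v => dneg (v ord0)
  | DBot => fun=> \bot
  | DTop => fun=> \top
  end.

Definition dm_structure {d} (D : deMorganType d) : structure dm_signature :=
  @Structure dm_signature D (@dm_interp d D).

Variant bdm_symbol := BJoin | BMeet | BCompl | BNeg | BBot | BTop.

Definition bdm_arity (f : bdm_symbol) : nat :=
  match f with BJoin | BMeet => 2 | BCompl | BNeg => 1 | BBot | BTop => 0 end.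

Definition bdm_signature := Signature bdm_arity.

Definition bdm_interp {d} (D : booleDeMorganType d) (f : bdm_symbol) :
    ('I_(bdm_arity f) -> D) -> D :=
  match f return ('I_(bdm_arity f) -> D) -> D with
  | BJoin => fun v => v ord0 `|` v ord_max
  | BMeet => fun v => v ord0 `&` v ord_max
  | BCompl => fun v => ~` v ord0
  | BNeg => fun v => dneg (v ord0)
  | BBot => fun=> \bot
  | BTop => fun=> \top
  end.

Definition bdm_structure {d} (D : booleDeMorganType d) :
    structure bdm_signature :=
  @Structure bdm_signature D (@bdm_interp d D).

Definition consistent (n : nat) (s : 'S_n) (I1 I2 I3 : {set 'I_n}) : Prop :=
  [/\ s @: I2 = I2, s @: I3 = I3
    & (I1 :&: I2 :&: I3) :&: s @: (I1 :&: I2 :&: I3) = finset.set0].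

Definition vanishes_exactly {d} {D : Order.TBDistrLattice.type d} {n : nat}
    (I : {set 'I_n}) (y : 'I_n -> D) (u : D) : Prop :=
  (forall i, i \in I -> y i `&` u = \bot) /\
  (forall i, i \notin I -> y i `&` u <> \bot).

Definition ecbda_phi {d} {D : booleDeMorganType d} {n : nat}
    (I1 I2 I3 : {set 'I_n}) (y : 'I_n -> D) (x : D) : Prop :=
  [/\ vanishes_exactly I1 y (x `&` dneg x),
      vanishes_exactly I2 y (x `&` dstar x)
    & vanishes_exactly I3 y (~` x `&` dneg x)].

(* The Boole-De Morgan axioms are carried by the type of [D]. *)
Definition ECBDA {d} (D : booleDeMorganType d) : Prop :=
  forall (n : nat) (s : 'S_n) (I1 I2 I3 : {set 'I_n}),
    (1 <= n)%N -> (s * s = 1)%g -> consistent s I1 I2 I3 ->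
  forall y : 'I_n -> D,
    (forall i, y i <> \bot) ->
    \join_(i < n) y i = \top ->
    (forall i j, i <> j -> y i `&` y j = \bot) ->
    (forall i, dstar (y i) = y (s i)) ->
  exists x : D, ecbda_phi I1 I2 I3 y x.

Definition ecda_psi {d} {D : deMorganType d} {n : nat}
    (I : {set 'I_n}) (y : 'I_n -> D) (x : D) : Prop :=
  vanishes_exactly I y (x `&` dneg x).

Definition ecda_xi {d} {D : deMorganType d} {n : nat}
    (I : {set 'I_n}) (y : 'I_n -> D) (x : D) : Prop :=
  exists z : D, [/\ dneg x `|` z = \top, dneg x `&` z = \bot
                  & vanishes_exactly I y (x `&` z)].

Definition ecda_chi {d} {D : deMorganType d} {n : nat}
    (I : {set 'I_n}) (y : 'I_n -> D) (x : D) : Prop :=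
  exists z : D, [/\ x `|` z = \top, x `&` z = \bot
                  & vanishes_exactly I y (z `&` dneg x)].

Definition ecda_phi {d} {D : deMorganType d} {n : nat}
    (I1 I2 I3 : {set 'I_n}) (y : 'I_n -> D) (x : D) : Prop :=
  [/\ ecda_psi I1 y x, ecda_xi I2 y x & ecda_chi I3 y x].

(* The complemented De Morgan axioms are carried by the type of [D]. *)
Definition ECDA {d} (D : complDeMorganType d) : Prop :=
  forall (n : nat) (s : 'S_n) (I1 I2 I3 : {set 'I_n}),
    (1 <= n)%N -> (s * s = 1)%g -> consistent s I1 I2 I3 ->
  forall y : 'I_n -> D,
    (forall i, y i <> \bot) ->
    \join_(i < n) y i = \top ->
    (forall i j, i <> j -> y i `&` y j = \bot) ->
    (forall i, dneg (y i) `|` y (s i) = \top /\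
               dneg (y i) `&` y (s i) = \bot) ->
  exists x : D, ecda_phi I1 I2 I3 y x.

(* Main.v *)
(** Write [x^* = ~` dneg x]: an involutive automorphism, so a Boole-De Morgan
    algebra is a Boolean algebra with an involution. The subalgebra [<b>]
    generated by a finite tuple [b] is finite, its atoms are the nonzero cells
    of [b], and the isomorphism type of [(b, x)] only records, for each atom [y]
    of [<b>], which of [x x^*], [x ~x^*], [~x x^*], [~x ~x^*] meet [y]. The
    axioms realize every such pattern compatible with [^*] over every finite
    subalgebra. Hence tuples with the same vanishing cells form a back-and-forth
    system and satisfy the same formulas. Moreover a pattern over [<b>] can be
    pulled back to the atoms of any finite [<e>] containing [<b>]; if [x] is not
    in [<b>], some atom of [<b>] is split by [x], and a realization of the
    pulled-back pattern splits the atoms of [<e>] below it, so avoids [e]. A set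
    definable over [b] with a point off [<b>] is therefore infinite. *)

Require Import Defs.
From HB Require Import structures.
From mathcomp Require Import all_boot all_order all_fingroup.
From mathcomp Require Import boolp classical_sets cardinality.

Set Implicit Arguments.
Unset Strict Implicit.
Unset Printing Implicit Defensive.

Import Order.Theory.

Local Open Scope order_scope.

(** Makes the general distributivity lemmas for iterated operators available for finite joins, as in
    [cell_cover] and [unsplit_generated]. *)
HB.instance Definition _ d (L : Order.TBDistrLattice.type d) :=
  Monoid.isAddLaw.Build L Order.meet Order.join
    (@meetUl d L) (@meetUr d L).

Lemma env_cons0 (X : Type) n (x : X) (e : 'I_n -> X) : env_cons x e ord0 = x.
Proof. by rewrite /env_cons unlift_none. Qed.

Lemma env_consS (X : Type) n (x : X) (e : 'I_n -> X) k :
  env_cons x e (lift ord0 k) = e k.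
Proof. by rewrite /env_cons liftK. Qed.

Lemma comp_env_cons (X : Type) n m (e : 'I_m -> X) i (r : 'I_n -> 'I_m) :
  e \o env_cons i r = env_cons (e i) (e \o r).
Proof. by apply/funext => k; rewrite /env_cons /=; case: unlift. Qed.

(** * The involution [dstar], regions and cells *)

Section BooleDeMorgan.
Context {d : Order.disp_t} {D : booleDeMorganType d}.
Implicit Types (x y z a : D) (r : bool * bool).

Lemma compl_unique x z : x `|` z = \top -> x `&` z = \bot -> z = ~` x.
Proof.
move=> xz1 xz0; apply/le_anti; rewrite -disj_leC meetC xz0 eqxx /=.
by rewrite -[~` x]meetx1 -xz1 meetUr meetCx join0x leIr.
Qed.

Lemma dneg_le x y : x <= y -> dneg y <= dneg x.
Proof. by move=> /join_idPr <-; rewrite dnegU leIl. Qed.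

Lemma dneg1 : dneg (\top : D) = \bot.
Proof.
by apply/eqP; rewrite -lex0 -[leRHS]dnegK; apply: dneg_le; rewrite lex1.
Qed.

Lemma dneg0 : dneg (\bot : D) = \top.
Proof. by rewrite -dneg1 dnegK. Qed.

Lemma dnegI x y : dneg (x `&` y) = dneg x `|` dneg y.
Proof. by apply: (can_inj dnegK); rewrite dnegU !dnegK. Qed.

(** [dneg] is an anti-automorphism of the lattice, so it sends complements to complements. *)
Lemma dnegC x : dneg (~` x) = ~` dneg x.
Proof.
apply: compl_unique; first by rewrite -dnegI meetxC dneg0.
by rewrite -dnegU joinxC dneg1.
Qed.

Lemma dstarK : involutive (@dstar d D).
Proof. by move=> x; rewrite /dstar dnegC complK dnegK. Qed.

Lemma dstarI x y : dstar (x `&` y) = dstar x `&` dstar y.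
Proof. by rewrite /dstar dnegI complU. Qed.

Lemma dstar_le x y : x <= y -> dstar x <= dstar y.
Proof. by move=> xy; rewrite leC dneg_le. Qed.

Lemma dstarC x : dstar (~` x) = ~` dstar x.
Proof. by rewrite /dstar dnegC. Qed.

Lemma dstar0 : dstar (\bot : D) = \bot.
Proof. by rewrite /dstar dneg0 compl1. Qed.

Lemma dstar1 : dstar (\top : D) = \top.
Proof. by rewrite /dstar dneg1 compl0. Qed.

Lemma dstar_eq0 x : dstar x = \bot <-> x = \bot.
Proof.
split=> [x0|->]; last exact: dstar0.
by rewrite -[x]dstarK x0 dstar0.
Qed.

Definition lit (b : bool) x : D := if b then x else ~` x.

(* Up to zero, the atoms of the subalgebra generated by [x]. *)
Definition region r x : D := lit r.1 x `&` lit r.2 (dstar x).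

Definition swap r : bool * bool := (r.2, r.1).

Lemma dstar_lit b x : dstar (lit b x) = lit b (dstar x).
Proof. by case: b => //=; rewrite dstarC. Qed.

Lemma dstar_region r x : dstar (region r x) = region (swap r) x.
Proof. by rewrite /region dstarI !dstar_lit dstarK meetC. Qed.

Lemma region_disjoint r r' x : r != r' -> region r x `&` region r' x = \bot.
Proof.
have litN b b' y : b != b' -> lit b y `&` lit b' y = \bot.
  by case: b b' => [] [] // _; rewrite /lit ?meetxC ?meetCx.
case: r r' => b c [b' c'] /=; rewrite /region /= xpair_eqE negb_and meetACA.
by case/orP => /litN ->; rewrite ?meet0x ?meetx0.
Qed.

Lemma region_cover x : \join_r region r x = \top.
Proof.
have litU b y : lit b y `|` lit (~~ b) y = \top.
  by case: b; rewrite /lit ?joinxC ?joinCx.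
apply/eqP; rewrite -le1x.
rewrite -[leLHS](litU true x) -[lit true x]meetx1 -[lit (~~ true) x]meetx1.
rewrite -(litU true (dstar x)) !meetUr !leUx.
have le_r r : region r x <= \join_r region r x by exact: joins_sup.
rewrite (le_r (true, true)) (le_r (true, false)) (le_r (false, true)).
by rewrite (le_r (false, false)).
Qed.

Lemma region_cover_eq0 a x :
  (forall r, a `&` region r x = \bot) -> a = \bot.
Proof.
move=> ax0; rewrite -[a]meetx1 -(region_cover x).
by apply: joins_disjoint => r _.
Qed.

Lemma lit_eq0 b a x :
  a `&` lit b x = \bot <-> forall c, a `&` region (b, c) x = \bot.
Proof.
split=> [ax0 c|ax0]; first by rewrite /region meetA ax0 meet0x.
apply: (@region_cover_eq0 _ x) => -[b' c]; have [<-|bb'] := eqVneq b b'.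
  by apply/eqP; rewrite -lex0 -(ax0 c) leI2 ?leIl.
rewrite /region -meetA (meetA (lit b x)).
by case: b b' bb' {ax0} => [] [] // _; rewrite ?meetxC ?meetCx meet0x meetx0.
Qed.

Section Cells.
Variable J : finType.
Implicit Types (e : J -> D) (t : {ffun J -> bool * bool}).

(* The atoms of the subalgebra generated by the family [e], up to zero. *)
Definition cell e t : D := \meet_j region (t j) (e j).

Definition swapf t : {ffun J -> bool * bool} := [ffun j => swap (t j)].

Lemma swapfK : involutive swapf.
Proof. by move=> t; apply/ffunP => j; rewrite !ffunE; case: (t j). Qed.

Lemma dstar_cell e t : dstar (cell e t) = cell e (swapf t).
Proof.
rewrite /cell (big_morph _ dstarI dstar1).
by apply: eq_bigr => j _; rewrite dstar_region ffunE.
Qed.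

Lemma cell_le e t j : cell e t <= region (t j) (e j).
Proof. exact: meets_inf. Qed.

Lemma cell_disjoint e t t' : t != t' -> cell e t `&` cell e t' = \bot.
Proof.
move=> tt'; have [j tj] : exists j, t j != t' j.
  apply/existsP; apply: contraNT tt'; rewrite negb_exists => /forallP tj.
  by apply/eqP/ffunP => j; apply/eqP; rewrite -[_ == _]negbK.
apply/eqP; rewrite -lex0 -(region_disjoint (e j) tj).
by rewrite leI2 ?cell_le.
Qed.

Lemma cell_cover e : \join_t cell e t = \top.
Proof.
(* Distributivity turns the join over all choices of one region per index into a meet of full joins
   of regions. *)
rewrite /cell -(bigA_distr_bigA (fun j r => region r (e j))).
by apply: big1 => j _; exact: region_cover.
Qed.

Lemma cell_cover_eq0 e a : (forall t, cell e t `&` a = \bot) -> a = \bot.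
Proof.
move=> ea0; rewrite -[a]meetx1 -(cell_cover e).
by apply: joins_disjoint => t _; rewrite meetC.
Qed.

Lemma cell_decides e t j :
  cell e t `&` e j = \bot \/ cell e t `&` ~` e j = \bot.
Proof.
have := cell_le e t j; rewrite /region lexI => /andP[+ _].
rewrite /lit; case: (t j).1; last by rewrite -disj_leC => /eqP; left.
by rewrite -[in X in X -> _](complK (e j)) -disj_leC => /eqP; right.
Qed.

End Cells.

Lemma cell_pullback (J K : finType) (i : K -> J) (e : J -> D)
    (t : {ffun J -> bool * bool}) :
  cell e t <= cell (e \o i) [ffun k => t (i k)].
Proof.
by apply/meetsP => k _; rewrite ffunE; exact: cell_le.
Qed.

(** A coarse cell is the join of the fine cells whose index restricts to [s]: any other fine cell
    lies in a different, hence disjoint, coarse cell. *)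
Lemma cell_pullback_eq0 (J K : finType) (i : K -> J) (e : J -> D)
    (s : {ffun K -> bool * bool}) a :
  (forall t : {ffun J -> bool * bool}, [ffun k => t (i k)] = s ->
     cell e t `&` a = \bot) ->
  cell (e \o i) s `&` a = \bot.
Proof.
move=> ea0; apply: (@cell_cover_eq0 _ e) => t.
have [/ea0 ta0|ts] := eqVneq [ffun k => t (i k)] s.
  by rewrite meetCA ta0 meetx0.
apply/eqP; rewrite -lex0 -(cell_disjoint (e \o i) ts) meetA.
by rewrite leIx2 // leI2 // cell_pullback.
Qed.

Lemma cell_refine (J K : finType) (i : K -> J) (e : J -> D)
    (s : {ffun K -> bool * bool}) :
    cell (e \o i) s <> \bot ->
  exists2 t : {ffun J -> bool * bool},
    [ffun k => t (i k)] = s & cell e t != \bot.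
Proof.
apply: contra_notP => no; rewrite -[LHS]meetx1.
apply: cell_pullback_eq0 => t ts.
have [->|t0] := eqVneq (cell e t) \bot; first by rewrite meet0x.
by case: no; exists t.
Qed.

End BooleDeMorgan.

(** * Finitely generated subalgebras and their partial isomorphisms *)

Section Generated.
Context {d : Order.disp_t} {D : booleDeMorganType d}.

(** Replaces the existence of an isomorphism between the generated subalgebras carrying [b] to
    [b']. *)
Definition same_cells (J : finType) (b b' : J -> D) : Prop :=
  forall t, cell b t = \bot <-> cell b' t = \bot.

Lemma cell_env_cons n x (b : 'I_n -> D) t :
  cell (env_cons x b) t =
  cell b [ffun k => t (lift ord0 k)] `&` region (t ord0) x.
Proof.
rewrite /cell big_ord_recl meetC /env_cons unlift_none /=.
by congr (_ `&` _); apply: eq_bigr => k _; rewrite liftK ffunE.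
Qed.

(** One step of the back-and-forth. The pattern of [x] is prescribed on the cells of the larger
    family [e], which leaves room for making [x] avoid [e]. Meeting a region can be tested on fine
    cells, and each nonzero coarse cell contains a nonzero fine one. *)
Lemma same_cells_env_cons (J : finType) n (i : 'I_n -> J) (b : 'I_n -> D)
    (e : J -> D) x0 x :
    same_cells b (e \o i) ->
    (forall t, cell e t != \bot -> forall r,
       cell e t `&` region r x = \bot <->
       cell b [ffun k => t (i k)] `&` region r x0 = \bot) ->
  same_cells (env_cons x0 b) (env_cons x (e \o i)).
Proof.
move=> be xx0 t; rewrite !cell_env_cons.
set s := [ffun k => _]; split=> [bs0|es0].
  apply: cell_pullback_eq0 => u us.
  have [->|u0] := eqVneq (cell e u) \bot; first by rewrite meet0x.
  by apply/(xx0 u u0); rewrite us.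
have [->|/eqP bs] := eqVneq (cell b s) \bot; first by rewrite meet0x.
have [|u us u0] := @cell_refine _ _ _ _ i e s; first by move/be.
rewrite -us; apply/(xx0 u u0); apply/eqP; rewrite -lex0 -es0 -us.
by rewrite leI2 // cell_pullback.
Qed.

Lemma bdm_generated_sub (A : set D) : is_bdm_subalgebra (bdm_generated A).
Proof.
split; try by move=> S [[]].
- by move=> x y Ax Ay; split=> S SA; have [[_ _ SUI _ _] _] := SA;
    case: (SUI _ _ (Ax S SA) (Ay S SA)).
- by move=> x Ax S SA; have [[_ _ _ SC _] _] := SA; exact: SC (Ax S SA).
- by move=> x Ax S SA; have [[_ _ _ _ SN] _] := SA; exact: SN (Ax S SA).
Qed.

Lemma bdm_meets (S : set D) (J : finType) (P : pred J) (F : J -> D) :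
  is_bdm_subalgebra S -> (forall j, P j -> S (F j)) -> S (\meet_(j | P j) F j).
Proof.
by case=> _ S1 SUI _ _ SF; apply: (big_ind S) => // x y Sx Sy; apply SUI.
Qed.

Lemma bdm_joins (S : set D) (J : finType) (P : pred J) (F : J -> D) :
  is_bdm_subalgebra S -> (forall j, P j -> S (F j)) -> S (\join_(j | P j) F j).
Proof.
by case=> S0 _ SUI _ _ SF; apply: (big_ind S) => // x y Sx Sy; apply SUI.
Qed.

Lemma bdm_cell (S : set D) (J : finType) (b : J -> D) t :
  is_bdm_subalgebra S -> (forall j, S (b j)) -> S (cell b t).
Proof.
move=> Ssub Sb; apply: bdm_meets => // j _.
case: Ssub => _ _ SUI SC Sneg; have Slit c x : S x -> S (lit c x).
  by case: c => // /SC.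
by apply SUI; apply: Slit; rewrite // /dstar; do 2?[apply: SC | apply: Sneg].
Qed.

(** An element that splits no cell is the join of the cells below it. *)
Lemma unsplit_generated (S : set D) (J : finType) (b : J -> D) x :
    is_bdm_subalgebra S -> (forall j, S (b j)) ->
    (forall t, cell b t `&` x = \bot \/ cell b t `&` ~` x = \bot) -> S x.
Proof.
move=> Ssub Sb bx; suff -> : x = \join_(t | cell b t <= x) cell b t.
  by apply: bdm_joins => // t _; exact: bdm_cell.
apply/le_anti/andP; split; last exact/joinsP.
rewrite -[x in leLHS]meetx1 -(cell_cover b) (big_distrr x) /=.
apply/joinsP => t _; have [tx|/eqP] := bx t; first by rewrite meetC tx le0x.
rewrite disj_leC complK => tx; apply: leIx2; rewrite orbC.
by rewrite joins_sup.
Qed.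

(** A subalgebra of the square of [D], seen as a relation. Asking the basic operations of a language
    to preserve all such relations covers both signatures at once. *)
Definition bdm_stable (R : D -> D -> Prop) : Prop :=
  [/\ R \bot \bot, R \top \top,
      forall x x' y y', R x x' -> R y y' ->
        R (x `|` y) (x' `|` y') /\ R (x `&` y) (x' `&` y'),
      forall x x', R x x' -> R (~` x) (~` x')
    & forall x x', R x x' -> R (dneg x) (dneg x')].

Lemma lit_join c (u v : bool) (x y : D) : c <= lit u x -> c <= lit v y ->
  c <= lit (u || v) (x `|` y).
Proof.
case: u v => [] [] /=; rewrite /lit => cx cy; rewrite ?complU ?lexI ?cx //.
- by rewrite lexUl.
- by rewrite lexUl.
- by rewrite lexUr.
Qed.

Lemma lit_compl (u : bool) (x : D) : lit (~~ u) (~` x) = lit u x.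
Proof. by case: u; rewrite /lit //= complK. Qed.

(** When [b] and [b'] have the same vanishing cells, this is the graph of the isomorphism between
    the subalgebras they generate, described without constructing the map. *)
Definition corr (J : finType) (b b' : J -> D) (a a' : D) : Prop :=
  forall t, exists u, cell b t <= lit u a /\ cell b' t <= lit u a'.

Lemma corr_stable (J : finType) (b b' : J -> D) : bdm_stable (corr b b').
Proof.
have corrC x x' : corr b b' x x' -> corr b b' (~` x) (~` x').
  by move=> xx' t; have [u] := xx' t; exists (~~ u); rewrite !lit_compl.
have corrU x x' y y' : corr b b' x x' -> corr b b' y y' ->
    corr b b' (x `|` y) (x' `|` y').
  move=> xx' yy' t; have [u [bx bx']] := xx' t; have [v [cy cy']] := yy' t.
  by exists (u || v); split; exact: lit_join.
have corr1 : corr b b' \top \top by move=> t; exists true; rewrite /= !lex1.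
split=> //.
- by rewrite -compl1; exact: corrC.
- move=> x x' y y' xx' yy'; split; first exact: corrU.
  rewrite -[x `&` y]complK -[x' `&` y']complK !complI.
  by apply/corrC/corrU; exact: corrC.
- move=> x x' xx'; rewrite -[dneg x]complK -[dneg x']complK; apply: corrC => t.
  (* What remains concerns [dstar x], and [dstar] exchanges the cells of indices [t] and
     [swapf t]. *)
  have [u] := xx' (swapf t); rewrite -!dstar_cell => -[bx bx']; exists u.
  rewrite -/(dstar x) -/(dstar x') -!dstar_lit.
  by split; rewrite -[leLHS]dstarK; apply: dstar_le.
Qed.

Lemma corr_gen (J : finType) (b b' : J -> D) j : corr b b' (b j) (b' j).
Proof.
move=> t; exists (t j).1.
by split; apply: (le_trans (cell_le _ _ j)); rewrite leIl.
Qed.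

(** A cell of [b'] on which [a'] is not below [c'] has the index of a cell of [b] lying under both
    [a] and the complement of [c], hence zero. With antisymmetry this makes [corr] single-valued. *)
Lemma corr_le (J : finType) (b b' : J -> D) a a' c c' :
  same_cells b b' -> corr b b' a a' -> corr b b' c c' -> a <= c -> a' <= c'.
Proof.
move=> bb' aa' cc' ac; rewrite -[c']complK -disj_leC; apply/eqP.
apply: (@cell_cover_eq0 _ _ _ b') => t; apply/eqP; rewrite -lex0.
have [[] [ba ba']] := aa' t; last first.
  by rewrite -(meetCx a') meetA leIx2 // leI2.
have [[] [bc bc']] := cc' t.
  by rewrite -(meetxC c') [a' `&` _]meetC meetA leIx2 // leI2.
have /bb' -> : cell b t = \bot; last by rewrite meet0x.
by apply/eqP; rewrite -lex0 -(meetxC c) lexI bc (le_trans ba).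
Qed.

End Generated.

(** * Homogeneity of models of ECBDA and the upper bound on [acl] *)

Section Homogeneity.
Context {d : Order.disp_t} {D : booleDeMorganType d}.
Hypothesis ecD : ECBDA D.

(* Only the pieces [y t <> \bot] satisfy the premises of ECBDA, so they are
   enumerated; the trivial algebra has none. *)
Lemma ECBDA_finType (T : finType) (v : T -> T) (y : T -> D)
    (I1 I2 I3 : pred T) :
    involutive v -> (forall t, dstar (y t) = y (v t)) ->
    \join_t y t = \top -> (forall t t', t != t' -> y t `&` y t' = \bot) ->
    (forall t, I2 (v t) = I2 t) -> (forall t, I3 (v t) = I3 t) ->
    (forall t, I1 t -> I1 (v t) -> I2 t -> I3 t -> y t = \bot) ->
  exists x, forall t, y t != \bot ->
    [/\ (y t `&` region (true, false) x == \bot) = I1 t,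
        (y t `&` region (true, true) x == \bot) = I2 t
      & (y t `&` region (false, false) x == \bot) = I3 t].
Proof.
move=> vK ystar y1 y0 I2v I3v Icons.
pose S := [set t | y t != \bot]%SET.
have [S0|[t0 t0S]] := set_0Vmem S.
  by exists \bot => t yt; have := finset.in_set0 t; rewrite -S0 inE yt.
have Sv t : t \in S -> v t \in S.
  rewrite !inE; apply: contraNN => /eqP vt0.
  by apply/eqP/dstar_eq0; rewrite ystar.
pose rk := enum_rank_in t0S.
have rkK t : t \in S -> enum_val (rk t) = t by exact: enum_rankK_in.
have evS (i : 'I_#|S|) : enum_val i \in S by exact: enum_valP.
pose f (i : 'I_#|S|) := rk (v (enum_val i)).
have fE i : enum_val (f i) = v (enum_val i) by rewrite rkK // Sv.
have fK : involutive f by move=> i; apply: enum_val_inj; rewrite !fE vK.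
pose s := perm (inv_inj fK).
have sK : involutive s by move=> i; rewrite !permE fK.
have imS (I : {set 'I_#|S|}) :
    (forall i, (s i \in I) = (i \in I)) -> s @: I = I.
  move=> Is; apply/setP => i.
  by rewrite -{1}(sK i) mem_imset ?Is //; exact: perm_inj.
pose I (P : pred T) := [set i : 'I_#|S| | P (enum_val i)]%SET.
have S_gt0 : (1 <= #|S|)%N by rewrite (leq_trans _ (ltn_ord (rk t0))).
have ss : (s * s = 1)%g by apply/permP => i; rewrite permM perm1 sK.
have cons : consistent s (I I1) (I I2) (I I3).
  split; try by apply: imS => i; rewrite !inE permE fE.
  (* An index in both the intersection and its image would satisfy the premises of [Icons], although
     its piece is nonzero. *)
  apply/setP => i; rewrite !inE -[X in X \in s @: _](sK i) mem_imset;
    last exact: perm_inj.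
  rewrite !inE permE fE; apply/negP => /andP[/andP[/andP[J1 J2] J3]].
  move=> /andP[/andP[J1' _] _]; move: (evS i).
  by rewrite inE (Icons _ J1 J1' J2 J3) eqxx.
have [||||x [[x11 x10] [x21 x20] [x31 x30]]] :=
    @ecD _ _ _ _ _ S_gt0 ss cons (fun i => y (enum_val i)).
- by move=> i; have := evS i; rewrite inE => /eqP.
- rewrite -(big_enum_val (A := mem S) y) -y1 [RHS](bigID (mem S)) /=.
  by rewrite [X in _ `|` X]big1 ?joinx0 // => t; rewrite inE negbK => /eqP.
- by move=> i j ij; apply: y0; apply/eqP => /enum_val_inj.
- by move=> i; rewrite ystar permE fE.
(* Through this identity the three elements tested by the axioms become the regions [(true, false)],
   [(true, true)] and [(false, false)]. *)
exists x => t; have dnegE : dneg x = ~` dstar x by rewrite /dstar complK.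
move=> yt; have tS : t \in S by rewrite inE.
rewrite -(rkK t tS) /region /= -dnegE.
have vE (P : pred T) u :
    (forall i, i \in I P -> y (enum_val i) `&` u = \bot) ->
    (forall i, i \notin I P -> y (enum_val i) `&` u <> \bot) ->
    (y (enum_val (rk t)) `&` u == \bot) = P (enum_val (rk t)).
  move=> u1 u0; apply/idP/idP => [/eqP uE|Pt].
    by apply: contraPT uE => Pt; apply: u0; rewrite inE.
  by apply/eqP/u1; rewrite inE.
by split; exact: vE.
Qed.

(** The pattern of [x0] over [b] is pulled back to the cells of [e] along restriction of indices. It
    commutes with [dstar], so the axioms realize it once consistency is checked. *)
Lemma extension (J K : finType) (i : K -> J) (b : K -> D) (e : J -> D) x0 :
    same_cells b (e \o i) ->
  exists x, forall t, cell e t != \bot -> forall r,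
    cell e t `&` region r x = \bot <->
    cell b [ffun k => t (i k)] `&` region r x0 = \bot.
Proof.
move=> be; pose q (t : {ffun J -> bool * bool}) := [ffun k => t (i k)].
pose I r t := cell b (q t) `&` region r x0 == \bot.
have qv t : q (swapf t) = swapf (q t) by apply/ffunP => k; rewrite !ffunE.
have Iv r t : I r (swapf t) = I (swap r) t.
  rewrite /I qv -dstar_cell.
  have -> : region r x0 = dstar (region (swap r) x0).
    by rewrite dstar_region; case: r.
  by rewrite -dstarI; apply/eqP/eqP => /dstar_eq0.
have [|||||||x xP] := @ECBDA_finType _ (@swapf J) (cell e)
  (I (true, false)) (I (true, true)) (I (false, false)).
- exact: swapfK.
- exact: dstar_cell.
- exact: cell_cover.
- exact: cell_disjoint.
- by move=> t; rewrite Iv.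
- by move=> t; rewrite Iv.
(* [I1] at [swapf t] is the region [(false, true)] at [t]. So [x0] has all four regions zero on the
   cell of [b], which therefore vanishes, and with it the cell of [e \o i] above [cell e t]. *)
- move=> t I1 /[!Iv] I1' I2 I3; apply/eqP; rewrite -lex0.
  suff <- : cell (e \o i) (q t) = \bot by exact: cell_pullback.
  apply/be/(@region_cover_eq0 _ _ _ x0) => -[[] []]; exact/eqP.
exists x => t et r; have [x1 x2 x3] := xP t et.
suff rE : (cell e t `&` region r x == \bot) = I r t.
  by split=> /eqP; [rewrite rE|rewrite -[_ == _]rE] => /eqP.
case: r => [[] []] //.
(* The remaining region [(false, true)] is not tested by the axioms; applying [dstar] reduces it to
   [(true, false)] on the swapped cell. *)
have vet : cell e (swapf t) != \bot.
  by apply: contraNneq et => /dstar_eq0; rewrite dstar_cell swapfK => ->.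
have [vE _ _] := xP _ vet.
rewrite -[RHS](Iv (true, false)) -vE -dstar_cell -(dstar_region (false, true)).
by rewrite -dstarI; apply/eqP/eqP => /dstar_eq0.
Qed.

(** Pulling the pattern of [x0] back to all of [e] gives the point: an [x] equal to some [e j] would
    split no cell of [e], so [x0] would split no cell of [e \o i] and would lie in [S]. *)
Lemma extension_avoiding (S : set D) (J : finType) n (i : 'I_n -> J)
    (e : J -> D) x0 :
    is_bdm_subalgebra S -> (forall k, S (e (i k))) -> ~ S x0 ->
  exists2 x, same_cells (env_cons x0 (e \o i)) (env_cons x (e \o i))
    & forall j, x <> e j.
Proof.
move=> Ssub Se x0S; have ee : same_cells (e \o i) (e \o i) by [].
have [x xx0] := extension x0 ee; exists x.
  exact: (same_cells_env_cons ee xx0).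
move=> j xj; apply: x0S; apply: (unsplit_generated (b := e \o i)) => // s.
have [s0|/eqP s0] := eqVneq (cell (e \o i) s) \bot.
  by left; rewrite s0 meet0x.
have [u us u0] := cell_refine s0.
have xx0s b : cell e u `&` lit b x = \bot ->
    cell (e \o i) s `&` lit b x0 = \bot.
  by move=> /lit_eq0 ux; apply/lit_eq0 => c; rewrite -us; exact/(xx0 u u0).
have := cell_decides e u j; rewrite -xj => -[ux|ux].
  by left; exact: (xx0s true).
by right; exact: (xx0s false).
Qed.

Section Structure.
Variables (L : signature) (ip : forall f : symbol L, ('I_(arity f) -> D) -> D).
Let M := Structure ip.

Lemma eval_stable (R : D -> D -> Prop) n (e e' : 'I_n -> M) (t : term L n) :
    (forall f (v v' : 'I_(arity f) -> D),
       (forall k, R (v k) (v' k)) -> R (ip v) (ip v')) ->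
  (forall k, R (e k) (e' k)) -> R (eval e t) (eval e' t).
Proof. by move=> Rip Re; elim: t => //= f ts IH; exact: Rip. Qed.

Hypothesis ip_stable : forall R, bdm_stable R ->
  forall f (v v' : 'I_(arity f) -> D),
  (forall k, R (v k) (v' k)) -> R (ip v) (ip v').

(** Every term takes [corr]-related values at [b] and [b'], and [corr] preserves order. *)
Lemma eval_eq n (b b' : 'I_n -> M) (t u : term L n) :
  same_cells b b' -> eval b t = eval b u -> eval b' t = eval b' u.
Proof.
move=> bb' tu; have ev v : corr b b' (eval b v) (eval b' v).
  apply: (eval_stable (R := corr b b')) => [f w w'|k]; last exact: corr_gen.
  exact: (ip_stable (corr_stable b b')).
by apply/le_anti; rewrite !(corr_le bb' (ev _) (ev _)) ?tu.
Qed.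

(** The back-and-forth argument: the quantifier step is [extension] along the identity, used in both
    directions. *)
Lemma sat_same_cells n (p : formula L n) (b b' : 'I_n -> M) :
  same_cells b b' -> sat p b <-> sat p b'.
Proof.
have sym m (e e' : 'I_m -> D) : same_cells e e' -> same_cells e' e.
  by move=> ee' t; split=> /ee'.
have ext m (e e' : 'I_m -> D) x : same_cells e e' ->
    exists x', same_cells (env_cons x e) (env_cons x' e').
  move=> ee'; have [x' xx'] := @extension _ _ id e e' x ee'; exists x'.
  exact: (same_cells_env_cons ee' xx').
elim: p b b' => {n} [n t u|n p IH|n p IHp q IHq|n p IH] b b' bb' /=.
- by split; apply: eval_eq => //; exact: sym.
- by rewrite (IH _ _ bb').
- by rewrite (IHp _ _ bb') (IHq _ _ bb').
- split=> -[x px].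
    by have [x' /IH xx'] := ext _ _ _ x bb'; exists x'; apply/xx'.
  by have [x' /IH xx'] := ext _ _ _ x (sym _ _ _ bb'); exists x'; apply/xx'.
Qed.

Lemma acl_sub (A : set D) : (@acl L M A `<=` bdm_generated A)%classic.
Proof.
move=> x0 [X [/finite_seqP[s Xs] [k [p [b [Ab Xp]]]]] Xx0].
apply: contrapT => x0A.
(* The family lists the parameters together with the finite definable set; a further point of the
   same type avoiding it is the contradiction. The default [\bot] is never reached. *)
pose e (j : 'I_k + 'I_(size s)) : D :=
  match j with inl i => b i | inr j => nth \bot s j end.
have [||x /sat_same_cells xx0 xe] := @extension_avoiding (bdm_generated A) _ k
  inl e x0 _ _ x0A.
- exact: bdm_generated_sub.
- by move=> i; apply: sub_gen_smallest; exact: Ab.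
have : X x by rewrite Xp /=; apply/xx0; move: Xx0; rewrite Xp.
rewrite Xs /= => /[dup] xs; rewrite -index_mem => lt_xs.
by apply: (xe (inr (Ordinal lt_xs))); rewrite /= nth_index.
Qed.

End Structure.
End Homogeneity.

(** * Renaming of variables and closure properties of [dcl] in any structure *)

Section Definability.
Context {L : signature} {M : structure L}.

Fixpoint term_ren n m (r : 'I_n -> 'I_m) (t : term L n) : term L m :=
  match t with
  | Var i => Var L (r i)
  | App f ts => App (fun k => term_ren r (ts k))
  end.

(** The renaming under a binder, which fixes the bound variable. *)
Definition lift_ren n m (r : 'I_n -> 'I_m) : 'I_n.+1 -> 'I_m.+1 :=
  env_cons ord0 (lift ord0 \o r).

Fixpoint formula_ren n (p : formula L n) :
    forall m, ('I_n -> 'I_m) -> formula L m :=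
  match p with
  | Eq _ t u => fun m r => Eq (term_ren r t) (term_ren r u)
  | Not _ q => fun m r => Not (formula_ren q r)
  | And _ q q' => fun m r => And (formula_ren q r) (formula_ren q' r)
  | Ex _ q => fun m r => Ex (formula_ren q (lift_ren r))
  end.

Lemma eval_ren n m (r : 'I_n -> 'I_m) (e : 'I_m -> M) t :
  eval e (term_ren r t) = eval (e \o r) t.
Proof.
by elim: t => //= f ts IH; congr interp; apply/funext => k; exact: IH.
Qed.

Lemma sat_ren n (p : formula L n) m (r : 'I_n -> 'I_m) (e : 'I_m -> M) :
  sat (formula_ren p r) e <-> sat p (e \o r).
Proof.
elim: p m r e => {n} [n t u|n p IH|n p IHp q IHq|n p IH] m r e /=.
- by rewrite !eval_ren.
- by rewrite IH.
- by rewrite IHp IHq.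
have env_ren x : env_cons x e \o lift_ren r = env_cons x (e \o r).
  rewrite comp_env_cons env_cons0; congr env_cons.
  by apply/funext => k /=; rewrite env_consS.
by split=> -[x] xp; exists x; move: xp; rewrite IH env_ren.
Qed.

Variable A : set M.

Lemma dclP x : dcl A x <-> definable A [set x].
Proof.
split=> [[X [[x' ->] Xdef] ->//]|xdef].
by exists [set x]%classic => //; split=> //; exists x.
Qed.

Lemma dcl_acl : (dcl A `<=` acl A)%classic.
Proof.
move=> x /dclP xdef.
by exists [set x]%classic => //; split=> //; exact: finite_set1.
Qed.

Lemma sub_dcl : (A `<=` dcl A)%classic.
Proof.
move=> a Aa; apply/dclP; exists 1, (Eq (Var L ord0) (Var L (lift ord0 ord0))).
exists (fun=> a); split=> //; apply/seteqP.
by split=> x /=; rewrite env_cons0 env_consS.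
Qed.

(* Unary operations are covered as binary ones ignoring an argument. *)
Definition op_definable (op : M -> M -> M) : Prop :=
  exists g : formula L 3, forall e : 'I_3 -> M,
    sat g e <-> e ord0 = op (e (lift ord0 ord0)) (e (lift ord0 ord_max)).

(** The value is defined by guessing both arguments, pinning each by its own formula, and stating
    the graph of [op]; the two parameter tuples are concatenated. *)
Lemma dcl_op (op : M -> M -> M) x y :
  op_definable op -> dcl A x -> dcl A y -> dcl A (op x y).
Proof.
move=> [g gP] /dclP[k [p [b [Ab xp]]]] /dclP[l [q [c [Ac yq]]]]; apply/dclP.
have pP u : sat p (env_cons u b) <-> u = x.
  by have -> : sat p (env_cons u b) = [set x]%classic u by rewrite xp.
have qP u : sat q (env_cons u c) <-> u = y.
  by have -> : sat q (env_cons u c) = [set y]%classic u by rewrite yq.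
pose up n (i : 'I_n) : 'I_n.+1 := lift ord0 i.
have upE n (z : M) (e : 'I_n -> M) i : env_cons z e (up n i) = e i.
  exact: env_consS.
(* Under the two quantifiers, index 0 is the second argument, 1 the first, 2 the value, and the
   parameters follow. *)
pose rp : 'I_k.+1 -> 'I_(k + l).+3 :=
  env_cons (up _ ord0) (fun i => up _ (up _ (up _ (lshift l i)))).
pose rq : 'I_l.+1 -> 'I_(k + l).+3 :=
  env_cons ord0 (fun i => up _ (up _ (up _ (rshift k i)))).
pose rg : 'I_3 -> 'I_(k + l).+3 :=
  env_cons (up _ (up _ ord0))
    (fun i : 'I_2 => if i == ord0 then up _ ord0 else ord0).
pose bc (i : 'I_(k + l)) := match split i with inl i => b i | inr i => c i end.
exists (k + l)%N.
exists (Ex (Ex (And (formula_ren p rp)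
  (And (formula_ren q rq) (formula_ren g rg))))).
exists bc; split=> [i|]; first by rewrite /bc; case: split.
suff sP w u v : sat (And (formula_ren p rp)
      (And (formula_ren q rq) (formula_ren g rg)))
    (env_cons v (env_cons u (env_cons w bc))) <->
    [/\ u = x, v = y & w = op u v].
  apply/seteqP; split=> w /=.
    by move=> ->; exists x, y; apply/sP.
  by move=> [u [v /sP[-> ->]]].
set e := env_cons v _.
have ep : e \o rp = env_cons u b.
  rewrite comp_env_cons; congr env_cons; first by rewrite /e upE env_cons0.
  by apply/funext => i; rewrite /e /= !upE /bc (unsplitK (inl i)).
have eq : e \o rq = env_cons v c.
  rewrite comp_env_cons; congr env_cons; first by rewrite /e env_cons0.
  by apply/funext => i; rewrite /e /= !upE /bc (unsplitK (inr i)).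
have eg0 : e (rg ord0) = w by rewrite /rg env_cons0 /e !upE env_cons0.
have eg1 : e (rg (lift ord0 ord0)) = u.
  by rewrite /rg env_consS /= /e upE env_cons0.
have eg2 : e (rg (lift ord0 ord_max)) = v.
  by rewrite /rg env_consS /= /e env_cons0.
rewrite /= !sat_ren gP ep eq /= eg0 eg1 eg2.
by rewrite pP qP; split=> [[-> [-> ->]]|[-> -> ->]].
Qed.

Lemma dcl_const (f : symbol L) c :
  (forall v, interp (s := M) (f := f) v = c) -> dcl A c.
Proof.
move=> fc; apply/dclP.
(* The arguments given to [f] are placeholders, since its value is [c] whatever they are. *)
exists 0%N, (Eq (Var L ord0) (App (fun _ : 'I_(arity f) => Var L ord0))).
exists (fun=> c); split=> [[] //|]; apply/seteqP.
by split=> x /=; rewrite fc env_cons0.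
Qed.

(** The map [r] routes the two arguments to the slots of [f]: the identity for binary symbols, a
    constant for unary ones. *)
Lemma op_definable_symbol (f : symbol L) (r : 'I_(arity f) -> 'I_2) op :
    (forall e : 'I_2 -> M,
       interp (fun k => e (r k)) = op (e ord0) (e ord_max)) ->
  op_definable op.
Proof.
move=> fop.
exists (Eq (Var L ord0) (App (fun k => Var L (lift ord0 (r k))))) => e /=.
by rewrite (fop (fun i => e (lift ord0 i))).
Qed.

End Definability.

(** * The closures in a language interdefinable with the Boole-De Morgan operations *)

Section Closures.
Context {d : Order.disp_t} {D : booleDeMorganType d}.
Variables (L : signature) (ip : forall f : symbol L, ('I_(arity f) -> D) -> D).
Let M := Structure ip.

(** A cycle of inclusions: the generated subalgebra lies in [dcl], [dcl] in [acl], and [acl] in the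
    generated subalgebra by homogeneity. *)
Lemma closures_eq (A : set D) : ECBDA D ->
    (forall R, bdm_stable R -> forall f (v v' : 'I_(arity f) -> D),
       (forall k, R (v k) (v' k)) -> R (ip v) (ip v')) ->
    @dcl L M A \bot -> @dcl L M A \top ->
    @op_definable L M Order.join -> @op_definable L M Order.meet ->
    @op_definable L M (fun x _ => ~` x) ->
    @op_definable L M (fun x _ => dneg x) ->
  @dcl L M A = bdm_generated A /\ @acl L M A = bdm_generated A.
Proof.
move=> ecD ipR dcl0 dcl1 defU defI defC defN.
have gen_dcl : (bdm_generated A `<=` @dcl L M A)%classic.
  apply: smallest_sub; last exact: (@sub_dcl L M A).
  split=> // [x y Ax Ay|x Ax|x Ax].
  - by split; [exact: (dcl_op defU)|exact: (dcl_op defI)].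
  - exact: (dcl_op defC Ax Ax).
  - exact: (dcl_op defN Ax Ax).
have dcl_acl' := @dcl_acl L M A; have acl_gen := acl_sub ecD ipR (A := A).
split; apply/seteqP; split=> // x; first by move=> /dcl_acl' /acl_gen.
by move=> /gen_dcl /dcl_acl'.
Qed.

End Closures.

(** * The language with complement *)

Section BooleDeMorganStructure.
Context {d : Order.disp_t} {D : booleDeMorganType d}.

Lemma bdm_interp_stable (R : D -> D -> Prop) f (v v' : 'I_(bdm_arity f) -> D) :
  bdm_stable R -> (forall k, R (v k) (v' k)) ->
  R (bdm_interp v) (bdm_interp v').
Proof.
case=> R0 R1 RUI RC RN; case: f v v' => v v' Rv //=.
- by case: (RUI _ _ _ _ (Rv ord0) (Rv ord_max)).
- by case: (RUI _ _ _ _ (Rv ord0) (Rv ord_max)).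
- exact/RC/Rv.
- exact/RN/Rv.
Qed.

Lemma bdm_closures (A : set D) : ECBDA D ->
  @dcl bdm_signature (bdm_structure D) A = bdm_generated A /\
  @acl bdm_signature (bdm_structure D) A = bdm_generated A.
Proof.
move=> ecD.
apply: closures_eq => // [R RS f v v'||||||].
- exact: bdm_interp_stable.
- exact: (@dcl_const _ (bdm_structure D) A BBot).
- exact: (@dcl_const _ (bdm_structure D) A BTop).
- exact: (@op_definable_symbol _ (bdm_structure D) BJoin id).
- exact: (@op_definable_symbol _ (bdm_structure D) BMeet id).
- exact: (@op_definable_symbol _ (bdm_structure D) BCompl (fun=> ord0)).
- exact: (@op_definable_symbol _ (bdm_structure D) BNeg (fun=> ord0)).
Qed.

End BooleDeMorganStructure.

(** * The language without complement *)

Section DeMorganStructure.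
Context {d : Order.disp_t} {D : complDeMorganType d}.
Local Notation B := (bdm_of D).

(** Complements are unique, so the witnesses [z] and [w] in the existential formulas must be
    [dstar x] and the complement of [x]. *)
Lemma ECDA_ECBDA : ECDA D -> ECBDA B.
Proof.
move=> ecD n s I1 I2 I3 n_gt0 ss cons y y_neq0 y1 y0 ystar.
have [||||x [x1 [z [xz1 xz0 x2]] [w [xw1 xw0 x3]]]] :=
    @ecD n s I1 I2 I3 n_gt0 ss cons y.
- exact: y_neq0.
- exact: y1.
- exact: y0.
- by move=> i; rewrite -ystar; split;
    [exact: (@joinxC _ B)|exact: (@meetxC _ B)].
exists x; split=> //.
  by rewrite /dstar -(@compl_unique _ B _ _ xz1 xz0).
by rewrite -(@compl_unique _ B _ _ xw1 xw0).
Qed.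

Lemma dm_interp_stable (R : B -> B -> Prop) f (v v' : 'I_(dm_arity f) -> B) :
  bdm_stable R -> (forall k, R (v k) (v' k)) ->
  R (dm_interp (D := D) v) (dm_interp (D := D) v').
Proof.
case=> R0 R1 RUI RC RN; case: f v v' => v v' Rv //=.
- by case: (RUI _ _ _ _ (Rv ord0) (Rv ord_max)).
- by case: (RUI _ _ _ _ (Rv ord0) (Rv ord_max)).
- exact/RN/Rv.
Qed.

Lemma dm_closures (A : set D) : ECDA D ->
  @dcl dm_signature (dm_structure D) A = @bdm_generated d B A /\
  @acl dm_signature (dm_structure D) A = @bdm_generated d B A.
Proof.
move=> /ECDA_ECBDA ecD.
apply: (@closures_eq _ B dm_signature (@dm_interp d D)) => //
  [R RS f v v'||||||].
- exact: dm_interp_stable.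
- exact: (@dcl_const _ (dm_structure D) A DBot).
- exact: (@dcl_const _ (dm_structure D) A DTop).
- exact: (@op_definable_symbol _ (dm_structure D) DJoin id).
- exact: (@op_definable_symbol _ (dm_structure D) DMeet id).
(* The complement is no symbol here; its graph is given by the two equations that characterize it.
   The same argument map serves [DJoin] and [DMeet], and is vacuous for the constants. *)
- pose app (f : dm_symbol) := @App dm_signature 3 f
    (fun k => @Var _ 3 (if k == 0%N :> nat then lift ord0 ord0 else ord0)).
  exists (And (Eq (app DJoin) (app DTop)) (Eq (app DMeet) (app DBot))) => e /=.
  split=> [[e1 e0]|->]; first exact: (@compl_unique _ B _ _ e1 e0).
  by split; [exact: (@joinxC _ B)|exact: (@meetxC _ B)].
- exact: (@op_definable_symbol _ (dm_structure D) DNeg (fun=> ord0)).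
Qed.

End DeMorganStructure.

Theorem theorem6p7 :
  (forall (d : Order.disp_t) (D : booleDeMorganType d), ECBDA D ->
     forall A : set D,
       @dcl bdm_signature (bdm_structure D) A = bdm_generated A /\
       @acl bdm_signature (bdm_structure D) A = bdm_generated A) /\
  (forall (d : Order.disp_t) (D : complDeMorganType d), ECDA D ->
     forall A : set D,
       @dcl dm_signature (dm_structure D) A = @bdm_generated d (bdm_of D) A /\
       @acl dm_signature (dm_structure D) A = @bdm_generated d (bdm_of D) A).
Proof.
by split=> d D ecD A; [exact: bdm_closures|exact: dm_closures].
Qed.
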